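(* Assume positivity: for any $a\in\mathring{\mathcal A}$ there exists $\epsilon_1(a)>0$ such that $p_{A\mid L}(a\mid L)\ge\epsilon_1(a)$ almost surely. Suppose that $\pi(Z,L)$ is a regular weighting function (RWF) for $A=a$. Then, for any regular nuisance function $\alpha_\pi(A,L)=[\mu_\pi(A,L),\rho_\pi(L),\kappa_\pi(A,L),\eta(A,L),\delta(A,L)]$, the quantity $\mathbb E[\varphi_\pi(O;\alpha_\pi,P_O)\mid A=a]-\mathbb E[\mu_\pi^o(a,L)]$ equals $$\mathbb E\Big[\frac{\delta(a,L)}{\kappa_\pi(a,L)}(\rho_\pi(L)-\rho_\pi^o(L))(\eta(a,L)-\eta^o(a,L))\,\Big|\,A=a\Big]$$ $$+\mathbb E\Big[\Big\{\delta^o(a,L)-\delta(a,L)\frac{\kappa_\pi^o(a,L)}{\kappa_\pi(a,L)}\Big\}\{\mu_\pi(a,L)-\mu_\pi^o(a,L)\}\,\Big|\,A=a\Big]$$ $$+\mathbb E\Big[(\rho_\pi(L)-\rho_\pi^o(L))\big(\delta^o(a,L)-\delta(a,L)\big)\frac{\eta(a,L)-\mu_\pi(a,L)}{\kappa_\pi(a,L)}\,\Big|\,A=a\Big].$$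
   Context: Setting. Observed data $O=[L,Z,A,Y]$ with law $P_O$, where $Y\in\mathcal Y\subseteq\mathbb R$ is an outcome, $A$ a continuous treatment whose support $\mathcal A\subseteq\mathbb R$ is closed (interior $\mathring{\mathcal A}$), $Z\in\mathcal Z\subseteq\mathbb R^{d_Z}$ an instrument, $L\in\mathcal L\subseteq\mathbb R^{d_L}$ observed confounders; $p_A$, $p_{A\mid L}$ are densities; $a\in\mathring{\mathcal A}$ is fixed. True nuisance functions. $Z_\pi:=\pi(Z,L)$, $z_\pi:=\pi(z,l)$; $\rho_\pi^o(L):=\mathbb E[Z_\pi\mid L]$; $\kappa_\pi^o(A,L):=\mathbb E[Z_\pi\mid A,L]-\mathbb E[Z_\pi\mid L]$; $\eta^o(A,L):=\mathbb E[Y\mid A,L]$; $\delta^o(A,L):=p_A(A)/p_{A\mid L}(A\mid L)$; $\mu_\pi^o(a,l):=\{\mathbb E[YZ_\pi\mid A=a,L=l]-\mathbb E[Y\mid A=a,L=l]\mathbb E[Z_\pi\mid L=l]\}/\kappa_\pi^o(a,l)$. RWF. A measurable $\pi:\mathcal Z\times\mathcal L\to\mathbb R$ is an RWF for $A=a$ if it is uniformly bounded and there is $\epsilon_\pi(a)>0$ with $|\kappa_\pi^o(a,L)|\ge\epsilon_\pi(a)$ almost surely. A nuisance function $\alpha_\pi=[\mu_\pi,\rho_\pi,\kappa_\pi,\eta,\delta]$ is a vector of candidate functions ($\rho_\pi$ of $L$, the others of $(A,L)$); ''regular'' means measurable with $\kappa_\pi$ nonvanishing and such that all displayed expectations are well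 defined. AIPW score. $$\varphi_\pi(O;\alpha_\pi,P_O):=\delta(A,L)\frac{Z_\pi-\rho_\pi(L)}{\kappa_\pi(A,L)}\{Y-\mu_\pi(A,L)\}+\int\Big\{\mu_\pi(A,l)-(z_\pi-\rho_\pi(l))\frac{\eta(A,l)-\mu_\pi(A,l)}{\kappa_\pi(A,l)}\Big\}\mathrm dP_O(o),$$ where the integral is over $o=(l,z,\cdot,\cdot)$ with $A$ held fixed.
   Formalization: Since A=a has probability zero, conditional laws and densities at a are fixed only up to null sets; the theorem assumes the chosen versions are consistent at a (p_A(a)=E[p_{A|L}(a|L)] and the Bayes/tower formula for the law given A=a), which holds for almost every a. *)

(* Defs.v *)
From HB Require Import structures.
From mathcomp Require Import all_boot all_order all_algebra.
From mathcomp Require Import all_classical all_reals all_analysis.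

Set Implicit Arguments.
Unset Strict Implicit.
Unset Printing Implicit Defensive.

Import Order.TTheory GRing.Theory Num.Theory.
Import numFieldNormedType.Exports.

Local Open Scope classical_set_scope.
Local Open Scope ring_scope.

(* A nonempty subset [S] of a measurable space, seen as a measurable space
   [trace S] of its own: its sigma-algebra is the trace one. Nonemptiness is
   only there because [measurableType]s are pointed. *)
Record neset (T : Type) := NESet {
  ne_carrier :> set T ;
  ne_nonempty : ne_carrier !=set0 }.

Definition ne_type (T : Type) (S : neset T) : Type := set_type (ne_carrier S).

Section ne_pointed.
Context (T : choiceType) (S : neset T).

Lemma ne_inhabited : inhabited (ne_type S).
Proof. by case: (ne_nonempty S) => x Sx; exists; exists x; exact/mem_set. Qed.

HB.instance Definition _ := Choice.on (ne_type S).
HB.instance Definition _ := isPointed.Build (ne_type S)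
  (let: exist x _ := cid (let: inhabits x := ne_inhabited in
                          ex_intro (fun _ : ne_type S => True) x I) in x).
End ne_pointed.

Definition ne_val (T : Type) (S : neset T) : ne_type S -> T := @set_val T S.

Definition trace d (T : measurableType d) (S : neset T) :=
  g_sigma_algebra_preimageType (@ne_val T S).

Definition pt d (T : measurableType d) (S : neset T) (x : trace S) : T :=
  @ne_val T S x.

(* [K] is a regular conditional law of [X] given [W] under [P]. *)
Definition is_conditional_law d d1 d2 (T : measurableType d)
    (T1 : measurableType d1) (T2 : measurableType d2) (R : realType)
    (P : probability T R) (W : T -> T1) (X : T -> T2)
    (K : R.-pker T1 ~> T2) : Prop :=
  forall (B : set T1) (C : set T2), measurable B -> measurable C ->
    P (W @^-1` B `&` X @^-1` C) = (\int[P]_(x in W @^-1` B) K (W x) C)%E.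

(* Topological support of the law of the real random variable [X]. *)
Definition law_support d (T : measurableType d) (R : realType)
    (P : probability T R) (X : T -> R) : set R :=
  [set t | forall U : set R, open U -> U t -> (0 < P (X @^-1` U))%E].

Section model.
Context (R : realType) (dL dZ : nat).
Context (SL : neset (dL.-tuple R)) (SZ : neset (dZ.-tuple R)).
Context (SA SY : neset R).

Local Notation TL := (trace SL).
Local Notation TZ := (trace SZ).
Local Notation TA := (trace SA).
Local Notation TY := (trace SY).

Definition obs : Type := (TL * TZ * TA * TY)%type.
HB.instance Definition _ := Measurable.on obs.

Definition oL (o : obs) : TL := o.1.1.1.
Definition oZ (o : obs) : TZ := o.1.1.2.
Definition oA (o : obs) : TA := o.1.2.
Definition oY (o : obs) : TY := o.2.

Context (PO : probability obs R).

(* Densities and conditional laws are determined by [PO] only up to null sets,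
   while they are to be evaluated at a fixed treatment value. A [versions] is a
   choice of one version of each of them:
     - [pA] is the density of [A] and [pAL t l] is p_{A|L}(t|l), both with
       respect to the Lebesgue measure;
     - [lawZ_L l] is the law of [Z] given [L = l];
     - [lawZY_AL (t, l)] is the law of [(Z, Y)] given [A = t, L = l];
     - [lawO_A t] is the law of [O] given [A = t]. *)
Record versions := Versions {
  pA : R -> R ;
  pAL : R -> TL -> R ;
  lawZ_L : R.-pker TL ~> TZ ;
  lawZY_AL : R.-pker (TA * TL)%type ~> (TZ * TY)%type ;
  lawO_A : R.-pker TA ~> obs ;
  pA_ge0 : forall t, 0 <= pA t ;
  pA_measurable : measurable_fun [set: R] pA ;
  pA_density : forall B : set R, measurable B ->
    PO [set o | B (pt (oA o))] =
    (\int[@lebesgue_measure R]_(t in B) (pA t)%:E)%E ;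
  pAL_ge0 : forall t l, 0 <= pAL t l ;
  pAL_measurable : measurable_fun [set: R * TL] (fun x => pAL x.1 x.2) ;
  pAL_density : forall (B : set R) (C : set TL), measurable B -> measurable C ->
    PO [set o | B (pt (oA o)) /\ C (oL o)] =
    (\int[PO]_(o in oL @^-1` C)
       \int[@lebesgue_measure R]_(t in B) (pAL t (oL o))%:E)%E ;
  lawZ_L_spec : is_conditional_law PO oL oZ lawZ_L ;
  lawZY_AL_spec : is_conditional_law PO
    (fun o => (oA o, oL o)) (fun o => (oZ o, oY o)) lawZY_AL ;
  lawO_A_spec : is_conditional_law PO oA id lawO_A }.

Context (V : versions).

(* The versions above are pairwise related only at almost every treatment
   value. This says that [a] is not an exceptional value: there, [pA] is the
   marginal of p_{A|L}, and the law of [O] given [A = a] is obtained by drawing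
   [L] from p_{A|L}(a|l) dP_L(l) / p_A(a), then [(Z, Y)] from its law given
   [A = a] and [L]. *)
Definition compatible_at (a : TA) : Prop :=
  ((pA V (pt a))%:E = \int[PO]_o (pAL V (pt a) (oL o))%:E)%E /\
  forall S : set obs, measurable S ->
    ((pA V (pt a))%:E * lawO_A V a S =
     \int[PO]_o ((pAL V (pt a) (oL o))%:E *
       lawZY_AL V (a, oL o) [set zy | S (oL o, zy.1, a, zy.2)]))%E.

Definition positivity : Prop :=
  forall t : R, interior SA t ->
    exists2 e1 : R, 0 < e1 & {ae PO, forall o, e1 <= pAL V t (oL o)}.

Section true_nuisance.
Context (pi : TZ -> TL -> R).

Definition rho_o (l : TL) : R := \int[lawZ_L V l]_z pi z l.

Definition kappa_o (t : TA) (l : TL) : R :=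
  \int[lawZY_AL V (t, l)]_zy pi zy.1 l - rho_o l.

Definition eta_o (t : TA) (l : TL) : R :=
  \int[lawZY_AL V (t, l)]_zy pt zy.2.

Definition delta_o (t : TA) (l : TL) : R := pA V (pt t) / pAL V (pt t) l.

Definition mu_o (t : TA) (l : TL) : R :=
  (\int[lawZY_AL V (t, l)]_zy (pt zy.2 * pi zy.1 l) - eta_o t l * rho_o l)
  / kappa_o t l.

Definition is_RWF (a : TA) : Prop :=
  [/\ measurable_fun [set: TZ * TL] (fun x => pi x.1 x.2),
      exists M : R, forall z l, `|pi z l| <= M
    & exists2 e : R, 0 < e & {ae PO, forall o, e <= `|kappa_o a (oL o)|}].

Record nuisance := Nuisance {
  mu : TA -> TL -> R ;
  rho : TL -> R ;
  kappa : TA -> TL -> R ;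
  eta : TA -> TL -> R ;
  delta : TA -> TL -> R }.

Context (alpha : nuisance).

(* The integrand, at [A = t], of the integral in the AIPW score. *)
Definition score_integrand (t : TA) (o : obs) : R :=
  mu alpha t (oL o) - (pi (oZ o) (oL o) - rho alpha (oL o))
    * ((eta alpha t (oL o) - mu alpha t (oL o)) / kappa alpha t (oL o)).

Definition score (o : obs) : R :=
  delta alpha (oA o) (oL o)
    * ((pi (oZ o) (oL o) - rho alpha (oL o)) / kappa alpha (oA o) (oL o))
    * (pt (oY o) - mu alpha (oA o) (oL o))
  + \int[PO]_o' score_integrand (oA o) o'.

Definition bias1 (a : TA) (l : TL) : R :=
  delta alpha a l / kappa alpha a l
    * (rho alpha l - rho_o l) * (eta alpha a l - eta_o a l).

Definition bias2 (a : TA) (l : TL) : R :=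
  (delta_o a l - delta alpha a l * (kappa_o a l / kappa alpha a l))
    * (mu alpha a l - mu_o a l).

Definition bias3 (a : TA) (l : TL) : R :=
  (rho alpha l - rho_o l) * (delta_o a l - delta alpha a l)
    * ((eta alpha a l - mu alpha a l) / kappa alpha a l).

(* The expectation E[Y Z_pi | A = a, L] is covered by the integrability of [Y],
   as weighting functions are bounded. *)
Definition expectations_well_defined (a : TA) : Prop :=
  [/\ {ae PO, forall o, (lawZY_AL V (a, oL o)).-integrable setT
                          (fun zy => (pt zy.2)%:E)},
      PO.-integrable setT (fun o => (mu_o a (oL o))%:E),
      PO.-integrable setT (fun o => (score_integrand a o)%:E),
      (lawO_A V a).-integrable setT (fun o => (score o)%:E)
    & [/\ (lawO_A V a).-integrable setT (fun o => (bias1 a (oL o))%:E),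
          (lawO_A V a).-integrable setT (fun o => (bias2 a (oL o))%:E)
        & (lawO_A V a).-integrable setT (fun o => (bias3 a (oL o))%:E)]].

Definition is_regular (a : TA) : Prop :=
  [/\ [/\ measurable_fun [set: TA * TL] (fun x => mu alpha x.1 x.2),
          measurable_fun [set: TL] (rho alpha),
          measurable_fun [set: TA * TL] (fun x => kappa alpha x.1 x.2),
          measurable_fun [set: TA * TL] (fun x => eta alpha x.1 x.2)
        & measurable_fun [set: TA * TL] (fun x => delta alpha x.1 x.2)],
      (forall t l, kappa alpha t l != 0)
    & expectations_well_defined a].

End true_nuisance.
End model.

(* Main.v *)
From HB Require Import structures.
Require Import Defs.
From mathcomp Require Import all_boot all_order all_algebra.
From mathcomp Require Import all_classical all_reals all_analysis.
From mathcomp Require Import measurable_realfun ring.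
Import Order.TTheory GRing.Theory Num.Theory.
Import numFieldNormedType.Exports.
Local Open Scope classical_set_scope.
Local Open Scope ring_scope.

(** At [A = a], compatibility disintegrates the law of [O] given [A = a] as
    [w(L) P_L(dl)] followed by the law of [(Z, Y)] given [(a, L)], where
    [w = p_{A|L}(a|.) / p_A(a)] is the reciprocal of [delta^o(a, .)].
    Everything can thus be computed under [P_O].  Conditionally on [L], the
    weighted residual product of the score integrates to
      [delta / kappa * ((mu^o - mu) kappa^o + (rho^o - rho) (eta^o - mu))],
    and the second term of the score is the constant
      [c = E[h(L)], h = mu - (rho^o - rho) (eta - mu) / kappa].
    Since [E[w(L)] = 1], the claim reduces to the almost sure identity
      [w * (inner score) = w * (bias1 + bias2 + bias3) - (h - mu^o) + c w]. *)

(** * Integrals of nonnegative functions against a weighted mixture of kernel measures *)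

Section mixture.
Local Open Scope ereal_scope.
Context {d d0 d1 d2 : measure_display} {T : measurableType d}
  {X : measurableType d0} {Y : measurableType d1} {Z : measurableType d2}
  {R : realType} {m : {measure set T -> \bar R}} {g : T -> X}
  {k : R.-sfker X ~> Y} {w : X -> R} {Phi : X * Y -> Z}
  {nu : {measure set Z -> \bar R}}.
Hypotheses (mg : measurable_fun [set: T] g) (mw : measurable_fun [set: X] w)
  (w0 : forall x, (0 <= w x)%R) (mPhi : measurable_fun [set: X * Y] Phi)
  (nuE : forall S, measurable S ->
    nu S = \int[m]_t ((w (g t))%:E * k (g t) [set y | S (Phi (g t, y))])).

Let mPhi2 x : measurable_fun [set: Y] (fun y => Phi (x, y)).
Proof. exact: measurableT_comp mPhi (pair1_measurable x). Qed.

Let mwg : measurable_fun [set: T] (fun t => (w (g t))%:E).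
Proof. by apply/measurable_EFinP; exact: measurableT_comp mw mg. Qed.

Let mw_inner f : (forall z, 0 <= f z) -> measurable_fun [set: Z] f ->
  measurable_fun [set: T]
    (fun t => (w (g t))%:E * \int[k (g t)]_y f (Phi (g t, y))).
Proof.
move=> f0 mf; apply: emeasurable_funM => //.
apply: (measurableT_comp (f := fun x => \int[k x]_y f (Phi (x, y))) _ mg).
apply: (measurable_fun_integral_sfinite_kernel (f \o Phi) k) => //.
  by move=> x; exact: f0.
exact: measurableT_comp.
Qed.

Import HBNNSimple.

Let integral_mixture_nnsfun (f : {nnsfun Z >-> R}) :
  \int[nu]_z (f z)%:E =
  \int[m]_t ((w (g t))%:E * \int[k (g t)]_y (f (Phi (g t, y)))%:E).
Proof.
rewrite integralT_nnsfun sintegralE.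
have mS x r : measurable [set y | (f @^-1` [set r]) (Phi (x, y))].
  by rewrite -[X in measurable X]setTI; exact: mPhi2.
have mk r : measurable_fun [set: T]
    (fun t => k (g t) [set y | (f @^-1` [set r]) (Phi (g t, y))]).
  (* Once written as the integral of an indicator, the kernel mass of a level set is measurable in
     [t] by the general result on integrals against s-finite kernels. *)
  pose h z := (\1_(f @^-1` [set r]) z)%:E : \bar R.
  rewrite (_ : (fun t => _) =
      fun t => \int[k (g t)]_y h (Phi (g t, y))); last first.
    apply/funext => t; rewrite (_ : (fun y => h _) =
      EFin \o \1_[set y | (f @^-1` [set r]) (Phi (g t, y))])//.
    by rewrite integral_indic// setIT.
  apply: (measurableT_comp (f := fun x => \int[k x]_y h (Phi (x, y))) _ mg).
  apply: (measurable_fun_integral_sfinite_kernel (h \o Phi) k) => //.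
    by move=> t; rewrite lee_fin.
  apply: measurableT_comp => //; apply/measurable_EFinP.
  exact: measurable_indic.
have inner t : \int[k (g t)]_y (f (Phi (g t, y)))%:E =
    \sum_(r \in range f)
      (r%:E * k (g t) [set y | (f @^-1` [set r]) (Phi (g t, y))]).
  under eq_integral do rewrite fimfunE -fsumEFin//.
  rewrite ge0_integral_fsum//; last 2 first.
    - move=> r; apply/measurable_EFinP; apply: measurable_funM => //.
      exact: measurableT_comp.
    - by move=> r z _; rewrite EFinM nnfun_muleindic_ge0.
  apply: eq_fsbigr => r _.
  rewrite (integralZl_indic _
    (fun r => [set y | (f @^-1` [set r]) (Phi (g t, y))]))//.
    by rewrite integral_indic// setIT.
  move=> r0; apply/seteqP; split => // y /= fr.
  by move: r0; rewrite -fr ltNge fun_ge0.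
(* Exchanging sum and integral requires nonnegative terms for every real [r], not only for the
   values of [f]. For negative [r] the level set is empty, because [f] is nonnegative. *)
have term0 r t :
    0 <= r%:E * k (g t) [set y | (f @^-1` [set r]) (Phi (g t, y))].
  have [r0|r0] := leP 0%R r; first by rewrite mule_ge0.
  rewrite (_ : [set y | _] = set0) ?measure0 ?mule0//.
  by apply/seteqP; split => // y /= fr; move: r0; rewrite -fr ltNge fun_ge0.
under [RHS]eq_integral => t _.
  rewrite inner ge0_mule_fsumr//.
  over.
rewrite ge0_integral_fsum//; last 2 first.
- by move=> r; apply: emeasurable_funM => //; exact: measurable_funeM.
- by move=> r t _; rewrite mule_ge0 ?lee_fin.
apply: eq_fsbigr => r _.
under [RHS]eq_integral do rewrite muleCA.
have [r0|r0] := leP 0%R r.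
  rewrite ge0_integralZl//; last 2 first.
  - exact: emeasurable_funM.
  - by move=> t _; rewrite mule_ge0 ?lee_fin.
  by rewrite nuE//; exact: measurable_sfunP.
rewrite integral0_eq ?preimage_nnfun0 ?measure0 ?mule0// => t _.
rewrite (_ : [set y | _] = set0) ?measure0 ?mule0//.
Qed.

(** Simple functions increase to [f]; monotone convergence is applied to [nu], then backwards to [m]
    and to each [k (g t)], the finite weight passing through the limit. *)
Lemma ge0_integral_mixture f : (forall z, 0 <= f z) ->
  measurable_fun [set: Z] f ->
  \int[nu]_z f z =
  \int[m]_t ((w (g t))%:E * \int[k (g t)]_y f (Phi (g t, y))).
Proof.
move=> f0 mf.
pose f_ := nnsfun_approx measurableT mf.
have nd_f z : {homo (fun n => (f_ n z)%:E) : n p / (n <= p)%N >-> n <= p}.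
  by move=> a b ab; rewrite lee_fin; exact/lefP/nd_nnsfun_approx.
have fE z : f z = limn (fun n => (f_ n z)%:E).
  by apply/esym/cvg_lim => //=; exact: cvg_nnsfun_approx.
under eq_integral do rewrite fE.
rewrite monotone_convergence//; last 2 first.
- by move=> n; exact/measurable_EFinP.
- by move=> n z _; rewrite lee_fin.
rewrite (_ : (fun n => _) = fun n => \int[m]_t ((w (g t))%:E *
    \int[k (g t)]_y (f_ n (Phi (g t, y)))%:E)); last first.
  by apply/funext => n; exact: integral_mixture_nnsfun.
have nd_inner t : {homo (fun n => \int[k (g t)]_y (f_ n (Phi (g t, y)))%:E) :
    n p / (n <= p)%N >-> n <= p}.
  move=> a b ab; apply: ge0_le_integral => //.
  - by move=> y _; rewrite lee_fin.
  - by apply/measurable_EFinP; exact: measurableT_comp.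
  - by apply/measurable_EFinP; exact: measurableT_comp.
  - by move=> y _; exact: nd_f.
rewrite -monotone_convergence//; last 3 first.
- move=> n; apply: (mw_inner (fun z => (f_ n z)%:E)) => [z|].
    by rewrite lee_fin.
  exact/measurable_EFinP.
- move=> n t _; rewrite mule_ge0 ?lee_fin//.
  by apply: integral_ge0 => y _; rewrite lee_fin.
- move=> t _ a b ab; apply: lee_pmul => //; rewrite ?lee_fin//.
    by apply: integral_ge0 => y _; rewrite lee_fin.
  exact: nd_inner.
apply: eq_integral => t _.
rewrite limeMl//; last exact: ereal_nondecreasing_is_cvgn.
congr (_ * _).
under [RHS]eq_integral do rewrite fE.
rewrite -monotone_convergence//.
- by move=> n; apply/measurable_EFinP; exact: measurableT_comp.
- by move=> n z _; rewrite lee_fin.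
Qed.

End mixture.

(** * Integrable real functions against a mixture *)

Lemma ae_eq_integrable {d} {T : measurableType d} {R : realType}
    {m : {measure set T -> \bar R}} {f h : T -> \bar R} :
  m.-integrable [set: T] f -> measurable_fun [set: T] h ->
  {ae m, forall t, f t = h t} -> m.-integrable [set: T] h.
Proof.
move=> /integrableP[mf foo] mh fh; apply/integrableP; split => //.
rewrite (_ : (\int[m]_t `|h t|)%E = (\int[m]_t `|f t|)%E)//.
apply: ge0_ae_eq_integral => //; try exact: measurableT_comp.
by apply: filterS fh => t fh _; rewrite fh.
Qed.

Section integral_mixture.
Context {d d0 d1 d2 : measure_display} {T : measurableType d}
  {X : measurableType d0} {Y : measurableType d1} {Z : measurableType d2}
  {R : realType} {m : {measure set T -> \bar R}} {g : T -> X}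
  {k : R.-sfker X ~> Y} {w : X -> R} {Phi : X * Y -> Z}
  {nu : {measure set Z -> \bar R}}.
Hypotheses (mg : measurable_fun [set: T] g) (mw : measurable_fun [set: X] w)
  (w0 : forall x, 0 <= w x) (mPhi : measurable_fun [set: X * Y] Phi)
  (nuE : forall S, measurable S ->
    nu S = (\int[m]_t ((w (g t))%:E * k (g t) [set y | S (Phi (g t, y))]))%E).

(* The inner integral may diverge where [w] vanishes or on a null set: there
   [Rintegral] gives a junk value, which does not affect the outer integral. *)
Lemma integral_mixture (f : Z -> R) : nu.-integrable [set: Z] (EFin \o f) ->
  let F t := w (g t) * \int[k (g t)]_y f (Phi (g t, y)) in
  m.-integrable [set: T] (EFin \o F) /\ \int[m]_t F t = \int[nu]_z f z.
Proof.
move=> fi F.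
pose P (h : Z -> \bar R) x := (\int[k x]_y h (Phi (x, y)))%E.
pose wP (h : Z -> \bar R) t := ((w (g t))%:E * P h (g t))%E.
have P_ge0 h x : (forall z, 0 <= h z)%E -> (0 <= P h x)%E.
  by move=> h0; apply: integral_ge0.
have mP h : (forall z, 0 <= h z)%E -> measurable_fun [set: Z] h ->
    measurable_fun [set: X] (P h).
  move=> h0 mh.
  apply: (measurable_fun_integral_sfinite_kernel (h \o Phi) k) => [x|].
    exact: h0.
  exact: measurableT_comp.
have mwg : measurable_fun [set: T] (fun t => (w (g t))%:E).
  by apply/measurable_EFinP; exact: measurableT_comp mw mg.
(* For nonnegative [h] the previous section gives equality of the integrals, so integrability passes
   from [nu] to [m]. This is then applied to the positive and negative parts of [f]. *)
have wPE h : (forall z, 0 <= h z)%E -> nu.-integrable [set: Z] h ->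
    m.-integrable [set: T] (wP h) /\ (\int[m]_t wP h t = \int[nu]_z h z)%E.
  move=> h0 hi; have mh : measurable_fun setT h by exact: measurable_int hi.
  have E : (\int[m]_t wP h t = \int[nu]_z h z)%E.
    by rewrite (ge0_integral_mixture mg mw w0 mPhi nuE).
  split => //; apply/integrableP; split.
    by apply: emeasurable_funM => //; exact: measurableT_comp (mP h h0 mh) mg.
  have wP0 t : (0 <= wP h t)%E by rewrite mule_ge0 ?lee_fin// P_ge0.
  by under eq_integral do rewrite (gee0_abs (wP0 _)); rewrite E integrable_lty.
set fp := (EFin \o f)^\+%E; set fn := (EFin \o f)^\-%E.
have fp0 z : (0 <= fp z)%E by exact: funepos_ge0.
have fn0 z : (0 <= fn z)%E by exact: funeneg_ge0.
have fpi : nu.-integrable [set: Z] fp by exact: integrable_funepos.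
have fni : nu.-integrable [set: Z] fn by exact: integrable_funeneg.
have [wPi wPi_E] := wPE fp fp0 fpi.
have [wNi wNi_E] := wPE fn fn0 fni.
have FE t : F t = w (g t) * fine (P fp (g t) - P fn (g t))%E.
  rewrite /F /Rintegral integralE.
  by congr (_ * fine (_ - _)%E); apply: eq_integral => y _;
    rewrite ?/fp ?/fn ?funeposE ?funenegE.
(* Being almost everywhere equal to a measurable function would not make [F] measurable; the formula
   [FE] does. *)
have mF : measurable_fun [set: T] (EFin \o F).
  apply/measurable_EFinP; rewrite (funext FE : F = _).
  apply: measurable_funM; first exact: measurableT_comp mw mg.
  apply: measurableT_comp => //.
  apply: emeasurable_funB; apply: (measurableT_comp _ mg).
    exact: mP (measurable_int _ fpi).
  exact: mP (measurable_int _ fni).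
(* Almost everywhere both weighted inner integrals are finite. If the weight is zero, both sides
   vanish; if it is positive, the inner integrals are themselves finite, so [fine] loses nothing and
   the weight distributes over the difference. *)
have Fae : {ae m, forall t, (wP fp t - wP fn t)%E = (F t)%:E}.
  have := integrable_ae measurableT wNi; have := integrable_ae measurableT wPi.
  apply: filterS2 => t /(_ I) Pfin /(_ I) Nfin; rewrite FE EFinM /wP.
  have [->|w_neq0] := eqVneq (w (g t)) 0; first by rewrite !mul0e sube0.
  have w_gt0 : (0 < (w (g t))%:E)%E.
    by rewrite lte_fin lt_neqAle eq_sym w_neq0 w0.
  have fin h : wP h t \is a fin_num -> P h (g t) \is a fin_num.
    rewrite /wP; case: (P h (g t)) => //=.
      by rewrite gt0_muley.
    by rewrite gt0_muleNy.
  have {}Pfin := fin _ Pfin; have {}Nfin := fin _ Nfin.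
  rewrite fineK; last by rewrite fin_numB Pfin Nfin.
  by rewrite [RHS]muleBr// fin_num_adde_defr.
have Fi := ae_eq_integrable (integrableB measurableT wPi wNi) mF Fae.
split => //; rewrite /Rintegral; congr fine.
transitivity (\int[m]_t (wP fp \- wP fn) t)%E.
  apply: ae_eq_integral => //.
    exact: measurable_int (integrableB measurableT wPi wNi).
  by apply: filterS Fae => t ->.
by rewrite integralB// wPi_E wNi_E [RHS]integralE.
Qed.

End integral_mixture.

(** * Disintegration of a joint law along a conditional law *)

Lemma conditional_law_joint {d d1 d2} {T : measurableType d}
    {T1 : measurableType d1} {T2 : measurableType d2} {R : realType}
    {P : probability T R} {W : T -> T1} {X : T -> T2} {K : R.-pker T1 ~> T2} :
  measurable_fun [set: T] W -> measurable_fun [set: T] X ->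
  is_conditional_law P W X K ->
  forall S, measurable S ->
    P ((fun t => (W t, X t)) @^-1` S) =
    (\int[P]_t K (W t) (pair (W t) @^-1` S))%E.
Proof.
move=> mW mX condK.
have mWX : measurable_fun [set: T] (fun t => (W t, X t)).
  exact: measurable_fun_pair.
have mpre (S : set (T1 * T2)) : measurable S ->
    measurable ((fun t => (W t, X t)) @^-1` S).
  by move=> mS; rewrite -[X in measurable X]setTI; exact: mWX.
have mpair x (S : set (T1 * T2)) : measurable S -> measurable (pair x @^-1` S).
  by move=> mS; rewrite -[X in measurable X]setTI; exact: pair1_measurable.
have mK (S : set (T1 * T2)) : measurable S ->
    measurable_fun [set: T] (fun t => K (W t) (pair (W t) @^-1` S)).
  move=> mS.
  apply: (measurableT_comp (f := fun x => K x (pair x @^-1` S)) _ mW).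
  under eq_fun do rewrite -xsectionE.
  by apply: measurable_fun_xsection_finite_kernel; rewrite inE.
have tpre (U : Type) (h : U -> T1 * T2) (F : (set (T1 * T2))^nat) :
    trivIset setT F -> trivIset setT (fun n => h @^-1` F n).
  move=> tF i j _ _ [x [Fi Fj]]; apply: (tF i j) => //.
  by exists (h x).
(* Dynkin's argument: the sets satisfying the formula form a lambda-system containing the
   rectangles, which are stable under intersection and generate the product sigma-algebra. *)
pose D := [set S : set (T1 * T2) | measurable S /\
  P ((fun t => (W t, X t)) @^-1` S) =
    (\int[P]_t K (W t) (pair (W t) @^-1` S))%E].
suff : measurable `<=` D by move=> MD S /MD[].
rewrite measurable_prod_measurableType.
have P1 : (\int[P]_t 1 = 1)%E.
  by rewrite integral_cst// mul1e; exact: probability_setT.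
have DT : D setT.
  split => //; rewrite preimage_setT probability_setT.
  under eq_integral do rewrite preimage_setT prob_kernel.
  by rewrite P1.
apply: lambda_system_subset => //.
- move=> _ _ [X1 mX1 [X2 mX2 <-]] [Y1 mY1 [Y2 mY2 <-]].
  exists (X1 `&` Y1); first exact: measurableI.
  by exists (X2 `&` Y2); [exact: measurableI|rewrite setXI].
- apply/dynkin_lambda_system; split => //.
  + move=> S [mS SE]; split; first exact: measurableC.
    have mCS := measurableC mS.
    (* On each side the contributions of [S] and its complement add up to 1. The common term for [S]
       is finite, hence cancels. *)
    have PU : (P ((fun t => (W t, X t)) @^-1` S) +
               P ((fun t => (W t, X t)) @^-1` (~` S)) = 1)%E.
      rewrite preimage_setC -measureU ?setICr//; last 2 first.
      - exact: mpre.
      - by apply: measurableC; exact: mpre.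
      by rewrite setUv; exact: probability_setT.
    have KU t : (1 = K (W t) (pair (W t) @^-1` S) +
                     K (W t) (pair (W t) @^-1` (~` S)))%E.
      rewrite preimage_setC -measureU ?setICr//; last 2 first.
      - exact: mpair.
      - by apply: measurableC; exact: mpair.
      by rewrite setUv; symmetry; exact: prob_kernel.
    move: PU; rewrite -[X in _ = X -> _]P1 (eq_integral _ _ (fun t _ => KU t)).
    rewrite ge0_integralD//; [|exact: mK|exact: mK].
    rewrite -SE => /(congr1 (fun x => x - P ((fun t => (W t, X t)) @^-1` S))%E).
    have Pfin : P ((fun t => (W t, X t)) @^-1` S) \is a fin_num.
      by apply: fin_num_measure; exact: mpre.
    by rewrite ![(_ + _ - _)%E]addeAC subee// !add0e.
  + move=> F tF DF.
    have mF n : measurable (F n) by case: (DF n).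
    split; first exact: bigcup_measurable.
    have bigcupE (d3 : measure_display) (U : measurableType d3)
        (Q : {measure set U -> \bar R}) (h : U -> T1 * T2) :
        (forall n, measurable (h @^-1` F n)) ->
        (Q (h @^-1` \bigcup_n F n) = \sum_(0 <= n <oo) Q (h @^-1` F n))%E.
      move=> mhF; rewrite preimage_bigcup measure_semi_bigcup//.
        exact: tpre.
      exact: bigcup_measurable.
    rewrite bigcupE; last by move=> n; exact: mpre.
    rewrite (eq_integral (fun t =>
        \sum_(0 <= n <oo) K (W t) (pair (W t) @^-1` F n))%E); last first.
      by move=> t _; apply: bigcupE => n; exact: mpair.
    rewrite integral_nneseries//; last by move=> n; exact: mK.
    by apply: eq_eseriesr => n _; case: (DF n).
- move=> _ [A mA [B mB <-]]; split; first exact: measurableX.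
  rewrite (_ : _ @^-1` _ = W @^-1` A `&` X @^-1` B)//.
  rewrite condK// integral_mkcond; apply: eq_integral => t _.
  rewrite patchE -xsectionE (_ : (t \in W @^-1` A) = (W t \in A)).
    case: ifPn => tA; first by rewrite in_xsectionX.
    by rewrite notin_xsectionX// measure0.
  by apply/idP/idP; rewrite !inE.
Qed.

(** The tower property. The law of [(W, X)] is the mixture with weight 1 and [Phi] the identity, so
    [integral_mixture] applies to it. *)
Lemma conditional_law_Rintegral {d d1 d2} {T : measurableType d}
    {T1 : measurableType d1} {T2 : measurableType d2} {R : realType}
    {P : probability T R} {W : T -> T1} {X : T -> T2} {K : R.-pker T1 ~> T2}
    {f : T1 * T2 -> R} :
  measurable_fun [set: T] W -> measurable_fun [set: T] X ->
  is_conditional_law P W X K -> measurable_fun [set: T1 * T2] f ->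
  P.-integrable [set: T] (EFin \o (fun t => f (W t, X t))) ->
  let F t := \int[K (W t)]_y f (W t, y) in
  P.-integrable [set: T] (EFin \o F) /\
  \int[P]_t F t = \int[P]_t f (W t, X t).
Proof.
move=> mW mX condK mf fi F.
have mWX : measurable_fun [set: T] (fun t => (W t, X t)).
  exact: measurable_fun_pair.
pose mixin := isMeasurableFun.Build _ _ _ _ _ mWX.
pose WX : {mfun T >-> (T1 * T2)%type} := HB.pack (fun t => (W t, X t)) mixin.
have nuE S : measurable S -> pushforward P WX S = (\int[P]_t
    ((cst 1 (W t))%:E * K (W t) [set y | S (idfun (W t, y))]))%E.
  move=> mS; rewrite /pushforward (conditional_law_joint mW mX condK)//.
  by apply: eq_integral => t _; rewrite mul1e.
have mfE : measurable_fun [set: T1 * T2] (EFin \o f) by exact/measurable_EFinP.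
have fi' : (pushforward P WX).-integrable [set: T1 * T2] (EFin \o f).
  exact: (integrable_pushforward mWX).
have mid : measurable_fun [set: T1 * T2] idfun by exact: measurable_id.
have m1 : measurable_fun [set: T1] (cst (1 : R)) by exact: measurable_cst.
have [Fi FE] := integral_mixture mW m1 (fun=> ler01) mid nuE f fi'.
have E : (fun t => cst 1 (W t) * \int[K (W t)]_y f (idfun (W t, y))) = F.
  by apply/funext => t; rewrite mul1r.
rewrite E in Fi FE; split => //; rewrite FE /Rintegral.
by rewrite (integral_pushforward mWX).
Qed.

(** * Calculus of real-valued integrals *)

Lemma eq_Rintegral_ae {d} {T : measurableType d} {R : realType}
    {m : {measure set T -> \bar R}} {f h : T -> R} :
  m.-integrable [set: T] (EFin \o f) -> m.-integrable [set: T] (EFin \o h) ->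
  {ae m, forall t, f t = h t} -> \int[m]_t f t = \int[m]_t h t.
Proof.
move=> fi hi fh; congr fine; apply: ae_eq_integral => //.
- exact: measurable_int fi.
- exact: measurable_int hi.
- by apply: filterS fh => t ->.
Qed.

Section integrable_real.
Context {d : measure_display} {T : measurableType d} {R : realType}
  {m : {measure set T -> \bar R}}.
Implicit Types (f h : T -> R) (c : R).

Lemma integrable_addr {f h} :
  m.-integrable [set: T] (EFin \o f) -> m.-integrable [set: T] (EFin \o h) ->
  m.-integrable [set: T] (EFin \o (fun t => f t + h t)).
Proof. by move=> fi hi; exact: (integrableD measurableT fi hi). Qed.

Lemma integrable_subr {f h} :
  m.-integrable [set: T] (EFin \o f) -> m.-integrable [set: T] (EFin \o h) ->
  m.-integrable [set: T] (EFin \o (fun t => f t - h t)).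
Proof. by move=> fi hi; exact: (integrableB measurableT fi hi). Qed.

Lemma integrable_scaler c {f} : m.-integrable [set: T] (EFin \o f) ->
  m.-integrable [set: T] (EFin \o (fun t => c * f t)).
Proof. by move=> fi; exact: (integrableZl measurableT c fi). Qed.

End integrable_real.

Section Rintegral_probability.
Context {d : measure_display} {T : measurableType d} {R : realType}
  {m : {measure set T -> \bar R}}.
(** Total mass one is a hypothesis so that these facts apply to each measure of a probability
    kernel, through [prob_kernel]. *)
Hypothesis m1 : m [set: T] = 1%E.
Implicit Types (f h : T -> R) (c : R).

Lemma Rintegral_cst1 c : \int[m]_t c = c.
Proof. by rewrite Rintegral_cst// m1 mulr1. Qed.

Lemma bounded_integrable1 {f} {M : R} : measurable_fun [set: T] f ->
  (forall t, `|f t| <= M) -> m.-integrable [set: T] (EFin \o f).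
Proof.
move=> mf fM; apply: measurable_bounded_integrable => //.
  by rewrite m1 ltry.
exists M; split; first exact: num_real.
by move=> N MN t _; exact: le_trans (fM t) (ltW MN).
Qed.

Lemma integrable_cst1 c : m.-integrable [set: T] (EFin \o (fun=> c)).
Proof.
by apply: (bounded_integrable1 (M := `|c|)) => //; exact: measurable_cst.
Qed.

End Rintegral_probability.

Lemma integrable_bounded_mulr {d} {T : measurableType d} {R : realType}
    {m : {measure set T -> \bar R}} {f h : T -> R} {M : R} :
  measurable_fun [set: T] f -> (forall t, `|f t| <= M) ->
  m.-integrable [set: T] (EFin \o h) ->
  m.-integrable [set: T] (EFin \o (fun t => h t * f t)).
Proof.
move=> mf fM hi.
apply: (@integrableMl _ _ _ m _ measurableT (EFin \o h) f hi mf).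
exists M; split; first exact: num_real.
by move=> N MN t _; exact: le_trans (fM t) (ltW MN).
Qed.

(** Expanding the product leaves [h * f], [h], [f] and constants, all integrable since [f] is
    bounded. With [f] the weighting function and [h] the outcome, this is the conditional mean of
    the score given the treatment and the confounders. *)
Lemma Rintegral_residual_product d (T : measurableType d) (R : realType)
    (m : {measure set T -> \bar R}) (f h : T -> R) (M dl rh ka mu c : R) :
  m [set: T] = 1%E -> measurable_fun [set: T] f -> (forall t, `|f t| <= M) ->
  m.-integrable [set: T] (EFin \o h) ->
  \int[m]_t (dl * ((f t - rh) / ka) * (h t - mu) + c) =
  dl / ka * (\int[m]_t (h t * f t) - rh * \int[m]_t h t - mu * \int[m]_t f t
             + rh * mu) + c.
Proof.
move=> m1 mf fM hi.
have fi := bounded_integrable1 m1 mf fM.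
have hfi := integrable_bounded_mulr mf fM hi.
transitivity (\int[m]_t (dl / ka * (h t * f t)
    + (- (dl / ka * rh)) * h t + (- (dl / ka * mu)) * f t
    + (dl / ka * rh * mu + c))).
  by apply: eq_Rintegral => t _; ring.
have i1 := integrable_scaler (dl / ka) hfi.
have i2 := integrable_scaler (- (dl / ka * rh)) hi.
have i3 := integrable_scaler (- (dl / ka * mu)) fi.
have i12 := integrable_addr i1 i2.
rewrite RintegralD//; [|exact: integrable_addr|exact: integrable_cst1].
rewrite RintegralD// RintegralD// !RintegralZl// Rintegral_cst1//.
ring.
Qed.

(** Inversion is continuous on the open complement of 0, and on a single point any function is
    measurable. *)
Lemma measurable_invr (R : realType) : measurable_fun [set: R] (@GRing.inv R).
Proof.
rewrite -(setvU [set 0]).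
apply/measurable_funU; [exact: measurableC|by []|split].
  apply: open_continuous_measurable_fun.
    by apply: closed_openC; exact: closed_eq.
  by move=> x /set_mem /eqP x_neq0; exact: inv_continuous.
exact: measurable_fun_set1.
Qed.

Lemma measurable_pt {d} {T : measurableType d} {S : neset T} :
  measurable_fun [set: trace S] (@pt d T S).
Proof. by move=> _ B mB; exists B. Qed.

(** * The law of the observation given [A = a] as a mixture over the confounders *)

Section model.
Context {R : realType} {dL dZ : nat}.
Context {SL : neset (dL.-tuple R)} {SZ : neset (dZ.-tuple R)} {SA SY : neset R}.
Local Notation TL := (trace SL).
Local Notation TZ := (trace SZ).
Local Notation TA := (trace SA).
Local Notation TY := (trace SY).
Local Notation obs := (obs SL SZ SA SY).
Context {PO : probability obs R} (V : versions PO) (a : TA).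

Lemma measurable_oL : measurable_fun [set: obs] (@oL R dL dZ SL SZ SA SY).
Proof.
exact: (measurableT_comp measurable_fst
  (measurableT_comp measurable_fst measurable_fst)).
Qed.

Lemma measurable_oZ : measurable_fun [set: obs] (@oZ R dL dZ SL SZ SA SY).
Proof.
exact: (measurableT_comp measurable_snd
  (measurableT_comp measurable_fst measurable_fst)).
Qed.

(** Serves as [Phi] in the mixture: the kernel [lawZY_AL] separates [(A, L)] from [(Z, Y)], and this
    restores the order of an observation. *)
Definition assemble (u : (TA * TL) * (TZ * TY)) : obs :=
  (u.1.2, u.2.1, u.1.1, u.2.2).

Lemma measurable_assemble : measurable_fun setT assemble.
Proof.
apply: measurable_fun_pair; last first.
  exact: (measurableT_comp measurable_snd measurable_snd).
apply: measurable_fun_pair; last first.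
  exact: (measurableT_comp measurable_fst measurable_fst).
apply: measurable_fun_pair.
  exact: (measurableT_comp measurable_snd measurable_fst).
exact: (measurableT_comp measurable_fst measurable_snd).
Qed.

(* At [t = a], the density of the law of [L] given [A = a] with respect to that
   of [L], i.e. the reciprocal of [delta_o V a]. *)
Definition density_ratio (x : TA * TL) : R := pAL V (pt x.1) x.2 / pA V (pt a).

Lemma density_ratio_ge0 x : 0 <= density_ratio x.
Proof. by rewrite divr_ge0 ?pAL_ge0 ?pA_ge0. Qed.

Lemma measurable_density_ratio : measurable_fun setT density_ratio.
Proof.
apply: measurable_funM => //.
apply: (measurableT_comp (g := fun x : TA * TL => (pt x.1, x.2))
  (pAL_measurable V)).
apply: measurable_fun_pair; last exact: measurable_snd.
exact: (measurableT_comp (measurable_pt) measurable_fst).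
Qed.

Lemma measurable_aL : measurable_fun [set: obs] (fun o => (a, oL o)).
Proof. by apply: measurable_fun_pair => //; exact: measurable_oL. Qed.

(** Compatibility at [a] divided by [pA V (pt a)], in the form that [integral_mixture] takes as its
    hypothesis [nuE]. *)
Lemma lawO_A_mixture : compatible_at V a -> 0 < pA V (pt a) ->
  forall S, measurable S -> lawO_A V a S =
  (\int[PO]_o ((density_ratio (a, oL o))%:E *
    lawZY_AL V (a, oL o) [set zy | S (assemble ((a, oL o), zy))]))%E.
Proof.
move=> [_ compat] p_gt0 S mS.
have /(congr1 (mule (pA V (pt a))^-1%:E)) := compat S mS.
rewrite muleA -EFinM mulVf ?gt_eqF// mul1e => ->.
have mK : measurable_fun [set: obs] (fun o =>
    lawZY_AL V (a, oL o) [set zy | S (assemble ((a, oL o), zy))]).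
  under eq_fun do
    rewrite -[X in lawZY_AL V _ X]/(pair _ @^-1` (assemble @^-1` S)) -xsectionE.
  apply: (measurableT_comp (f := fun x =>
    lawZY_AL V x (xsection (assemble @^-1` S) x)) _ measurable_aL).
  apply: measurable_fun_xsection_finite_kernel; rewrite inE.
  by rewrite -[X in measurable X]setTI; exact: measurable_assemble.
rewrite -ge0_integralZl//; last 3 first.
- apply: emeasurable_funM => //.
  apply/measurable_EFinP.
  apply: (measurableT_comp (g := fun o : obs => (pt a, oL o))
    (pAL_measurable V)).
  by apply: measurable_fun_pair => //; exact: measurable_oL.
- by move=> o _; rewrite mule_ge0// lee_fin pAL_ge0.
- by rewrite lee_fin invr_ge0 ltW.
apply: eq_integral => o _; rewrite muleA -EFinM; congr (_%:E * _)%E.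
by rewrite /density_ratio mulrC.
Qed.

End model.

(** * The bias decomposition of the score *)

Theorem lemmaF3 (R : realType) (dL dZ : nat)
    (SL : neset (dL.-tuple R)) (SZ : neset (dZ.-tuple R)) (SA SY : neset R)
    (PO : probability (obs SL SZ SA SY) R) (V : versions PO)
    (hSA_closed : closed (SA : set R))
    (hSA_support : (SA : set R) = law_support PO (fun o => pt (oA o)))
    (a : trace SA) (ha : interior SA (pt a))
    (hcompat : compatible_at V a)
    (hpos : positivity V)
    (pi : trace SZ -> trace SL -> R) (hpi : is_RWF V pi a)
    (alpha : nuisance SL SA) (halpha : is_regular V pi alpha a) :
  \int[lawO_A V a]_o score PO pi alpha o - \int[PO]_o mu_o V pi a (oL o) =
    \int[lawO_A V a]_o
      (delta alpha a (oL o) / kappa alpha a (oL o)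
        * (rho alpha (oL o) - rho_o V pi (oL o))
        * (eta alpha a (oL o) - eta_o V a (oL o)))
  + \int[lawO_A V a]_o
      ((delta_o V a (oL o)
          - delta alpha a (oL o) * (kappa_o V pi a (oL o) / kappa alpha a (oL o)))
        * (mu alpha a (oL o) - mu_o V pi a (oL o)))
  + \int[lawO_A V a]_o
      ((rho alpha (oL o) - rho_o V pi (oL o))
        * (delta_o V a (oL o) - delta alpha a (oL o))
        * ((eta alpha a (oL o) - mu alpha a (oL o)) / kappa alpha a (oL o))).
Proof.
case: hpi => mpi [M piM] [ek ek_gt0 kappa_ge].
case: halpha => [[mmu mrho mkappa meta mdelta] kappa_neq0
  [Yint mu_oi scoreIi scorei [bias1i bias2i bias3i]]].
have [e1 e1_gt0 pAL_ge] := hpos _ ha.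
set p := pA V (pt a).
(* By compatibility [p] is the mean of [pAL V (pt a)] over the confounders, hence at least the
   positivity constant [e1]. *)
have p_gt0 : 0 < p.
  apply: (lt_le_trans e1_gt0); rewrite -lee_fin /p hcompat.1.
  have mpAL : measurable_fun setT
      (fun o : obs SL SZ SA SY => (pAL V (pt a) (oL o))%:E).
    apply/measurable_EFinP.
    apply: (measurableT_comp (g := fun o : obs SL SZ SA SY => (pt a, oL o))
      (pAL_measurable V)).
    by apply: measurable_fun_pair => //; exact: measurable_oL.
  have -> : e1%:E = (\int[PO]_o e1%:E)%E.
    rewrite integral_cst// [X in (_ * X)%E](_ : _ = 1%E) ?mule1//.
    by exact: probability_setT.
  apply: ae_ge0_le_integral => //.
  - by move=> o _; rewrite lee_fin; exact: ltW e1_gt0.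
  - by move=> o _; rewrite lee_fin pAL_ge0.
  - by apply: filterS pAL_ge => o pALo _; rewrite lee_fin.
have mix := integral_mixture (measurable_aL a) (measurable_density_ratio V a)
  (density_ratio_ge0 V a) measurable_assemble
  (lawO_A_mixture V a hcompat p_gt0).
pose w (o : obs SL SZ SA SY) := density_ratio V a (a, oL o).
(* For a function of [L] alone the inner integral is that of a constant under a probability, so only
   the weight remains. *)
have mixL (b : trace SL -> R) :
    (lawO_A V a).-integrable setT (EFin \o (fun o => b (oL o))) ->
    PO.-integrable setT (EFin \o (fun o => w o * b (oL o))) /\
    \int[PO]_o (w o * b (oL o)) = \int[lawO_A V a]_o b (oL o).
  move=> bi; have [] := mix (fun o => b (oL o)) bi.
  have -> : (fun o => density_ratio V a (a, oL o) *
      \int[lawZY_AL V (a, oL o)]_y b (oL (assemble (a, oL o, y)))) =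
      (fun o => w o * b (oL o)).
    apply/funext => o; congr (_ * _).
    exact: (Rintegral_cst1 (prob_kernel (a, oL o)) (b (oL o))).
  by [].
have [scorewi scorewE] := mix (score PO pi alpha) scorei.
have [b1i b1E] := mixL (bias1 V pi alpha a) bias1i.
have [b2i b2E] := mixL (bias2 V pi alpha a) bias2i.
have [b3i b3E] := mixL (bias3 V pi alpha a) bias3i.
(* The case of the constant function 1: the weight has mean one. *)
have [wi wE] : PO.-integrable setT (EFin \o w) /\ \int[PO]_o w o = 1.
  have Q1 : lawO_A V a setT = 1%E by exact: prob_kernel.
  have [] := mixL (fun=> 1) (integrable_cst1 Q1 1).
  by under eq_fun do rewrite mulr1; rewrite (Rintegral_cst1 Q1).
have mpil l : measurable_fun setT (fun z => pi z l).
  apply: (measurableT_comp (g := fun z => (z, l)) mpi).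
  exact: measurable_fun_pair.
(* [f2] is the integral term's integrand at [a], as a function of [(L, Z)]; [h2], its mean given
   [L], is the [h] of the overview. The tower property for [lawZ_L] then yields [c] as the mean of
   [h2]. *)
pose f2 (lz : trace SL * trace SZ) := mu alpha a lz.1 -
  (pi lz.2 lz.1 - rho alpha lz.1) *
  ((eta alpha a lz.1 - mu alpha a lz.1) / kappa alpha a lz.1).
pose h2 l := mu alpha a l - (rho_o V pi l - rho alpha l) *
  ((eta alpha a l - mu alpha a l) / kappa alpha a l).
pose c := \int[PO]_o score_integrand pi alpha a o.
have [h2i h2E] : PO.-integrable setT (EFin \o (fun o => h2 (oL o))) /\
    \int[PO]_o h2 (oL o) = c.
  have mf2 : measurable_fun setT f2.
    have ml (b : trace SA -> trace SL -> R) :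
        measurable_fun setT (fun x => b x.1 x.2) ->
        measurable_fun setT (fun lz : trace SL * trace SZ => b a lz.1).
      move=> mb; apply: (measurableT_comp
        (g := fun lz : trace SL * trace SZ => (a, lz.1)) mb).
      exact: measurable_fun_pair.
    apply: measurable_funB; first exact: ml.
    apply: measurable_funM.
      apply: measurable_funB; last exact: measurableT_comp mrho measurable_fst.
      apply: (measurableT_comp
        (g := fun lz : trace SL * trace SZ => (lz.2, lz.1)) mpi).
      exact: measurable_fun_pair.
    apply: measurable_funM.
      by apply: measurable_funB; exact: ml.
    by apply: (measurableT_comp (measurable_invr R)); exact: ml.
  have [] := conditional_law_Rintegral measurable_oL measurable_oZ
    (lawZ_L_spec V) mf2 scoreIi.
  have -> : (fun o : obs SL SZ SA SY => \int[lawZ_L V (oL o)]_z f2 (oL o, z)) =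
      (fun o => h2 (oL o)); last by [].
  apply/funext => o; set l := oL o.
  set q := (eta alpha a l - mu alpha a l) / kappa alpha a l.
  have K1 : lawZ_L V l setT = 1%E by exact: prob_kernel.
  have pii : (lawZ_L V l).-integrable setT (EFin \o (fun z => pi z l)).
    by apply: (bounded_integrable1 K1 (mpil l)) => z.
  transitivity (\int[lawZ_L V l]_z
      (- q * pi z l + (mu alpha a l + rho alpha l * q))).
    by apply: eq_Rintegral => z _; rewrite /f2 /= -/q; ring.
  rewrite (RintegralD measurableT (integrable_scaler (- q) pii)
    (integrable_cst1 K1 _)) (RintegralZl (- q) measurableT pii).
  rewrite (Rintegral_cst1 K1).
  by rewrite /h2 -/q /rho_o; ring.
rewrite -scorewE -[X in _ = X + _ + _]b1E -[X in _ = _ + X + _]b2E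
  -[X in _ = _ + _ + X]b3E.
have b12i := integrable_addr b1i b2i.
have b123i := integrable_addr b12i b3i.
have hmi := integrable_subr h2i mu_oi.
have cwi := integrable_scaler c wi.
have bhi := integrable_subr b123i hmi.
transitivity (\int[PO]_o ((w o * bias1 V pi alpha a (oL o)
    + w o * bias2 V pi alpha a (oL o) + w o * bias3 V pi alpha a (oL o))
    - (h2 (oL o) - mu_o V pi a (oL o)) + c * w o)
    - \int[PO]_o mu_o V pi a (oL o)).
  congr (_ - _); apply: eq_Rintegral_ae => //; first exact: integrable_addr.
  (* The identity is only almost sure: it needs [Y] integrable given [(a, L)], and nonzero values of
     the true [kappa_o] and of [pAL], by which [mu_o] and [delta_o] divide. *)
  apply: filterS3 Yint kappa_ge pAL_ge => o Yo kappao pALo.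
  set l := oL o in Yo kappao pALo *.
  have K1 : lawZY_AL V (a, l) setT = 1%E by exact: prob_kernel.
  (* Every assembled observation has treatment [a], so the integral term of the score is the
     constant [c] here. *)
  have -> : \int[lawZY_AL V (a, l)]_zy score PO pi alpha (assemble (a, l, zy)) =
      delta alpha a l / kappa alpha a l *
      (\int[lawZY_AL V (a, l)]_zy (pt zy.2 * pi zy.1 l)
       - rho alpha l * eta_o V a l
       - mu alpha a l * \int[lawZY_AL V (a, l)]_zy pi zy.1 l
       + rho alpha l * mu alpha a l) + c.
    have mpi1 : measurable_fun setT (fun zy : trace SZ * trace SY => pi zy.1 l).
      exact: (measurableT_comp (mpil l) measurable_fst).
    exact: (Rintegral_residual_product _ _ _ _ _ _ _ (delta alpha a l)
      (rho alpha l) (kappa alpha a l) (mu alpha a l) c K1 mpi1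
      (fun zy => piM zy.1 l) Yo).
  have kappa_o_neq0 : kappa_o V pi a l != 0.
    by rewrite -normr_gt0; exact: lt_le_trans kappao.
  have pAL_neq0 : pAL V (pt a) l != 0.
    by rewrite gt_eqF//; exact: lt_le_trans pALo.
  have p_neq0 : p != 0 by rewrite gt_eqF.
  (* The definitions of [kappa_o] and [mu_o] are solved for the two remaining conditional means,
     which leaves an identity of rational functions. *)
  have -> : \int[lawZY_AL V (a, l)]_zy pi zy.1 l =
      kappa_o V pi a l + rho_o V pi l.
    by rewrite /kappa_o subrK.
  have -> : \int[lawZY_AL V (a, l)]_zy (pt zy.2 * pi zy.1 l) =
      mu_o V pi a l * kappa_o V pi a l + eta_o V a l * rho_o V pi l.
    by rewrite /mu_o divfK// subrK.
  (* Since the weight times [delta_o] is 1, the [delta_o] terms of the biases add up to [h2 - mu_o]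
     and cancel; the [delta] terms give the residual product. *)
  rewrite /bias1 /bias2 /bias3 /h2 /delta_o /w /density_ratio /= -/l -/p.
  move: (kappa_neq0 a l) => kappa_neq0'.
  field.
  by rewrite ?p_neq0 ?pAL_neq0 ?kappa_neq0'.
(* By linearity, the mean [c] of [h2] cancels [c] times the mean of the weight, and the two means of
   [mu_o] cancel as well. *)
rewrite (RintegralD measurableT bhi cwi) (RintegralB measurableT b123i hmi).
rewrite (RintegralD measurableT b12i b3i) (RintegralD measurableT b1i b2i).
rewrite (RintegralB measurableT h2i mu_oi) (RintegralZl c measurableT wi).
rewrite wE h2E; ring.
Qed.
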